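(* Let $N\geq 1$ and let $\operatorname{LSE}(\mathbf{x})=\log\left(\frac{1}{N}\sum_{k=1}^{N}e^{x_{k}}\right)$ for $\mathbf{x}\in\mathbb{R}^{N}$. Then \[ \operatorname{LSE}(\mathbf{x}+\mathbf{y}+\mathbf{z})+\operatorname{LSE}(\mathbf{z})\geq\operatorname{LSE}(\mathbf{x}+\mathbf{z})+\operatorname{LSE}(\mathbf{y}+\mathbf{z}) \] for all $\mathbf{x},\mathbf{y},\mathbf{z}\in\mathbb{R}_{+}^{N}$ such that $\mathbf{x}$ and $\mathbf{y}$ are comonotonic.
   Context: $\mathbb{R}_{+}^{N}=\{\mathbf{x}\in\mathbb{R}^{N}:x_{k}\geq 0 \text{ for all }k\}$. Two vectors $\mathbf{u},\mathbf{v}\in\mathbb{R}^{N}$ are comonotonic if $(u_{i}-u_{j})(v_{i}-v_{j})\geq 0$ for all indices $i,j\in\{1,\dots,N\}$. *)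

(* Defs.v *)
From mathcomp Require Import all_boot all_order all_algebra.
From mathcomp Require Import reals sequences exp.
Set Implicit Arguments.
Unset Strict Implicit.
Unset Printing Implicit Defensive.

Import Order.TTheory GRing.Theory Num.Theory.
Local Open Scope ring_scope.

(* Vectors of R^N are row vectors ['rV[R]_N]; the k-th coordinate of [x] is
   [x ord0 k]. *)

(* Only meaningful for [0 < N]. *)
Definition LSE (R : realType) (N : nat) (x : 'rV[R]_N) : R :=
  ln (1 / N%:R * \sum_(k < N) expR (x ord0 k)).

Definition nonneg_vec (R : realType) (N : nat) (x : 'rV[R]_N) : Prop :=
  forall k : 'I_N, 0 <= x ord0 k.

Definition comonotonic (R : realType) (N : nat) (u v : 'rV[R]_N) : Prop :=
  forall i j : 'I_N,
    0 <= (u ord0 i - u ord0 j) * (v ord0 i - v ord0 j).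

(* Main.v *)
Require Import Defs.
From mathcomp Require Import all_boot all_order all_algebra.
From mathcomp Require Import reals sequences exp.
From mathcomp Require Import ring.
Import Order.TTheory GRing.Theory Num.Theory.
Local Open Scope ring_scope.

(** Exponentiating, the inequality is Chebyshev's sum inequality for the
    families [e^(x_k)] and [e^(y_k)] with weights [e^(z_k)]; these families are
    similarly ordered because [exp] is increasing. *)

(** Expanding the product gives four double sums, each of which factors; exchanging [i] and [j]
    matches them in pairs, whence the factor 2. *)
Lemma chebyshev_sum_identity (R : comPzRingType) (I : finType) (w a b : I -> R) :
  \sum_i \sum_j w i * w j * ((a i - a j) * (b i - b j)) =
  ((\sum_i w i * a i * b i) * (\sum_i w i) -
   (\sum_i w i * a i) * (\sum_i w i * b i)) *+ 2.
Proof.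
(* Every monomial is arranged as a factor in [i] times a factor in [j], so that the inner and then
   the outer sum can be pulled out. *)
transitivity (\sum_i \sum_j ((w i * a i * b i) * w j + w i * (w j * a j * b j)
   - ((w i * a i) * (w j * b j) + (w i * b i) * (w j * a j)))).
  by apply: eq_bigr => i _; apply: eq_bigr => j _; ring.
under eq_bigr => i _ do rewrite sumrB !big_split /= -!mulr_sumr.
rewrite sumrB !big_split /= -!mulr_suml; ring.
Qed.

(** Twice the difference of the two sides is, by the identity, a double sum of nonnegative terms. *)
Lemma chebyshev_sum (R : realDomainType) (I : finType) (w a b : I -> R) :
  (forall i, 0 <= w i) ->
  (forall i j, 0 <= (a i - a j) * (b i - b j)) ->
  (\sum_i w i * a i) * (\sum_i w i * b i) <=
  (\sum_i w i * a i * b i) * (\sum_i w i).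
Proof.
move=> w0 ab; rewrite -subr_ge0 -(@pmulrn_lge0 _ _ 2) // -chebyshev_sum_identity.
by apply: sumr_ge0 => i _; apply: sumr_ge0 => j _; rewrite mulr_ge0 ?ab // mulr_ge0.
Qed.

Lemma expR_similarly_ordered (R : realType) (a b c d : R) :
  0 <= (a - b) * (c - d) ->
  0 <= (expR a - expR b) * (expR c - expR d).
Proof.
(* A strict sign of [a - b] forces the weak sign of [c - d], and [expR] preserves both. If [a = b],
   nothing is known about [c - d], but the product vanishes. *)
case: (ltgtP a b) => [ab|ba|->]; last by rewrite !subrr !mul0r.
- rewrite nmulr_rge0 ?subr_lt0 // nmulr_rge0 ?subr_lt0 ?ltr_expR //.
  by rewrite !subr_le0 ler_expR.
- rewrite pmulr_rge0 ?subr_gt0 // pmulr_rge0 ?subr_gt0 ?ltr_expR //.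
  by rewrite !subr_ge0 ler_expR.
Qed.

Lemma sum_expR_gt0 (R : realType) (N : nat) (x : 'rV[R]_N) :
  (0 < N)%N -> 0 < \sum_(k < N) expR (x ord0 k).
Proof.
case: N x => // N x _; rewrite big_ord_recl ltr_wpDr ?expR_gt0 //.
by apply: sumr_ge0 => i _; rewrite expR_ge0.
Qed.

Theorem mainTheorem7 (R : realType) (N : nat) (hN : (1 <= N)%N)
    (x y z : 'rV[R]_N)
    (hx : nonneg_vec x) (hy : nonneg_vec y) (hz : nonneg_vec z)
    (hxy : comonotonic x y) :
  LSE (x + y + z) + LSE z >= LSE (x + z) + LSE (y + z).
Proof.
have N0 : 0 < 1 / N%:R :> R by rewrite divr_gt0 ?ltr0n.
have mean_gt0 (v : 'rV[R]_N) : 0 < 1 / N%:R * \sum_(k < N) expR (v ord0 k).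
  by rewrite mulr_gt0 ?sum_expR_gt0.
rewrite /LSE -!lnM ?posrE ?mean_gt0 // ler_ln ?posrE; last 2 first.
- exact: mulr_gt0 (mean_gt0 _) (mean_gt0 _).
- exact: mulr_gt0 (mean_gt0 _) (mean_gt0 _).
(* Both sides carry the same positive factor [(1 / N%:R) * (1 / N%:R)], which cancels and leaves
   products of plain sums. *)
rewrite [leLHS]mulrACA [leRHS]mulrACA ler_pM2l; last exact: mulr_gt0.
(* The factor [expR (z ord0 k)] is split off as the weight; the sum coming from [LSE z] is already
   the total weight. *)
have -> : \sum_k expR ((x + z) ord0 k) = \sum_k expR (z ord0 k) * expR (x ord0 k).
  by apply: eq_bigr => k _; rewrite !mxE expRD mulrC.
have -> : \sum_k expR ((y + z) ord0 k) = \sum_k expR (z ord0 k) * expR (y ord0 k).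
  by apply: eq_bigr => k _; rewrite !mxE expRD mulrC.
have -> : \sum_k expR ((x + y + z) ord0 k) =
    \sum_k expR (z ord0 k) * expR (x ord0 k) * expR (y ord0 k).
  by apply: eq_bigr => k _; rewrite !mxE !expRD mulrC mulrA.
apply: chebyshev_sum => [i|i j]; first exact: expR_ge0.
exact/expR_similarly_ordered/hxy.
Qed.
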